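(* Let $\mathbb{K}$ be a field of characteristic zero. Let $m,k\geq 1$ be integers and let $r$ be an integer with $$r\geq k\left(k(m+1)+k+\frac{m(k-1)}{2}\right)=\frac{k}{2}(3km+4k-m).$$ Then there exists a nonempty Zariski open subset $U_{k,m,r}\subseteq\mathbb{K}[z]_{\leq r}$ such that, for every $\sigma\in U_{k,m,r}$ and every $k$-tuple of pairwise distinct nonconstant polynomials $p_1,\dots,p_k\in\mathbb{K}[t]$ of degree at most $m$, the polynomials $\sigma(p_1),\dots,\sigma(p_k)$ are linearly independent over $\mathbb{K}$ in $\mathbb{K}[t]$.
   Context: $\mathbb{K}[z]_{\leq r}$ denotes the $\mathbb{K}$-vector space of univariate polynomials of degree at most $r$, identified with the affine space $\mathbb{K}^{r+1}$ of coefficients with its Zariski topology. $\sigma(p)$ denotes the composition $\sigma(p(t))$. *)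

(* Defs.v *)
From mathcomp Require Import all_boot all_order all_algebra.
From mathcomp Require Import mpoly.

Set Implicit Arguments.
Unset Strict Implicit.
Unset Printing Implicit Defensive.

Import GRing.Theory.
Local Open Scope ring_scope.

Section Zariski.
Variables (K : fieldType) (n : nat).

(* {poly_n K} holds the polynomials of size at most n, i.e. of degree < n,
   and is identified with the affine space K^n through the coefficients. *)
Definition coefs (s : {poly_n K}) : 'I_n -> K := fun i => (s : {poly K})`_i.

Definition zero_locus (S : {mpoly K[n]} -> Prop) (s : {poly_n K}) : Prop :=
  forall f, S f -> f.@[coefs s] = 0.

Definition zariski_closed (Z : {poly_n K} -> Prop) : Prop :=
  exists S : {mpoly K[n]} -> Prop, forall s, Z s <-> zero_locus S s.

Definition zariski_open (U : {poly_n K} -> Prop) : Prop :=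
  zariski_closed (fun s => ~ U s).

End Zariski.

(* The library predicate [free] needs a finite-dimensional space, which
   {poly K} is not. *)
Definition lin_indep (K : fieldType) (V : lmodType K) (k : nat)
    (v : 'I_k -> V) : Prop :=
  forall c : 'I_k -> K, \sum_(i < k) c i *: v i = 0 -> forall i, c i = 0.

(* Main.v *)
Require Import Defs.
From mathcomp Require Import all_boot all_order all_algebra perm.
From mathcomp Require Import mpoly.
Set Implicit Arguments.
Unset Strict Implicit.
Unset Printing Implicit Defensive.
Import Order.TTheory GRing.Theory Num.Theory.
Local Open Scope ring_scope.

(** The theorem is a parameter count. Put E = k(m+1) + k, so that the bound on
r gives kE <= r. Suppose sigma(p_1), ..., sigma(p_k) are linearly dependent.

Since the characteristic is zero, some translation of t makes the values p_i(0)
pairwise distinct and the derivatives p_i'(0) nonzero; this keeps the degrees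
and the dependence ([exists_separating_translation]). Near t = 0 each p_i is
then a local coordinate at the point p_i(0), so knowing sigma(p_i) modulo t^E
amounts to knowing sigma modulo (z - p_i(0))^E. By Hermite interpolation at k
distinct points ([hermite_unique]), sigma is determined, through a linear
system whose matrix is polynomial in the coefficients of the p_i and invertible
([hermite_det_neq0]), by the k jets sigma(p_i) mod t^E together with the
coefficients of sigma of degree at least kE: in all r + 1 scalars.

A dependence relation expresses one of these jets, say the first one, through
the k - 1 others, so E of the r + 1 scalars are redundant. What remains to be
chosen is the coefficients of the p_i, the k - 1 coefficients of the relation
and r + 1 - E scalars: k(m+1) + (k-1) + (r+1-E) = r parameters. Hence all such
sigma lie in the image of a polynomial map from affine r-space to affine
(r+1)-space. The components of such a map satisfy a nonzero polynomial relation
F ([algebraic_dependence], by counting monomials), and F vanishes at every bad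
sigma ([dependence_locus]). The complement of the hypersurface F = 0 is the
required open set; it is nonempty because the field is infinite
([exists_meval_neq0]). *)

(** * Nonvanishing of polynomials in characteristic zero *)

Lemma natr_inj_pchar0 (K : fieldType) (charK0 : [pchar K] =i pred0) :
  injective (fun n => n%:R : K).
Proof.
have nat0 n : (n%:R == 0 :> K) = (n == 0)%N by move/pcharf0P: charK0 ->.
suff ltF a b : (a < b)%N -> a%:R != b%:R :> K.
  move=> a b eq_ab; case: (ltngtP a b) => // lt_ab.
    by move: (ltF _ _ lt_ab); rewrite eq_ab eqxx.
  by move: (ltF _ _ lt_ab); rewrite eq_ab eqxx.
move=> lt_ab; rewrite eq_sym -subr_eq0 -natrB ?(ltnW lt_ab) // nat0.
by rewrite -lt0n subn_gt0.
Qed.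

Lemma exists_nonroot (K : fieldType) (charK0 : [pchar K] =i pred0)
    (q : {poly K}) : q != 0 -> exists x, q.[x] != 0.
Proof.
move=> q0; pose s := [seq n%:R : K | n <- iota 0 (size q)].
have [/allP roots|/allPn [x _ nr]] := boolP (all (root q) s); last by exists x.
have us : uniq s by rewrite map_inj_uniq ?iota_uniq //; exact: natr_inj_pchar0.
have := max_poly_roots q0 (introT allP roots) us.
by rewrite size_map size_iota ltnn.
Qed.

(** Uniqueness of base-B expansions; it makes the substitution used in
[exists_meval_neq0] injective on monomials. *)
Lemma base_digits_inj (B n : nat) (f g : 'I_n -> nat) :
  (forall i, f i < B)%N -> (forall i, g i < B)%N ->
  (\sum_(i < n) f i * B ^ i = \sum_(i < n) g i * B ^ i)%N -> f =1 g.
Proof.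
elim: n f g => [|n IH] f g ltf ltg; first by move=> _ [].
have shift (h : 'I_n.+1 -> nat) :
    (\sum_(i < n.+1) h i * B ^ i =
     (\sum_(i < n) h (lift ord0 i) * B ^ i) * B + h ord0)%N.
  rewrite big_ord_recl muln1 addnC big_distrl /=; congr (_ + _)%N.
  by apply: eq_bigr => i _; rewrite -mulnA -expnSr.
have B0 : (0 < B)%N by apply: leq_ltn_trans (ltf ord0).
rewrite !shift => eq_fg.
have eq0 : f ord0 = g ord0.
  by move/(congr1 (modn^~ B)): eq_fg; rewrite !modnMDl !modn_small.
move: eq_fg; rewrite eq0 => /addIn/eqP; rewrite eqn_pmul2r // => /eqP eq_fg i.
have [j ->|->//] := unliftP ord0 i.
exact: (IH (fun j => f (lift ord0 j)) (fun j => g (lift ord0 j))).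
Qed.

(** Kronecker substitution: replacing the i-th variable by X^(B^i), with B
larger than all exponents of F, sends distinct monomials of F to distinct powers
of X, hence F to a nonzero univariate polynomial, which has a non-root. *)
Lemma exists_meval_neq0 (K : fieldType) (charK0 : [pchar K] =i pred0) (n : nat)
    (F : {mpoly K[n]}) : F != 0 -> exists v, F.@[v] != 0.
Proof.
move=> F0; pose B := msize F.
pose h (i : 'I_n) : {poly K} := 'X^(B ^ i).
pose code (m : 'X_{1..n}) := (\sum_(i < n) m i * B ^ i)%N.
have hE m : mmap1 h m = 'X^(code m).
  rewrite /mmap1 /code (big_morph _ (@exprD _ 'X) (expr0 _)).
  by apply: eq_bigr => i _; rewrite -exprM mulnC.
have digit m i : m \in msupp F -> (m i < B)%N.
  move=> /msize_mdeg_lt; apply: leq_ltn_trans.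
  by rewrite mdegE (bigD1 i) //= leq_addr.
have code_inj m m' : m \in msupp F -> m' \in msupp F ->
    code m = code m' -> m = m'.
  move=> mF m'F eq_code; apply/mnmP; apply: (base_digits_inj _ _ eq_code) => i;
  exact: digit.
pose m := mlead F.
have mF : m \in msupp F by exact: mlead_supp.
have P0 : mmap (@polyC K) h F != 0.
  apply/eqP => /(congr1 (fun p : {poly K} => p`_(code m))).
  rewrite coef0 /mmap coef_sum (bigD1_seq m) ?msupp_uniq //= big_seq_cond big1.
    move/eqP; rewrite addr0 hE coefCM coefXn eqxx mulr1.
    by rewrite mcoeff_eq0 mF.
  move=> m' /andP[m'F nm]; rewrite hE coefCM coefXn.
  case: eqP => [/code_inj eq_m|]; last by rewrite mulr0.
  by rewrite eq_m ?eqxx in nm.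
have [x nz] := exists_nonroot charK0 P0.
exists (fun i => x ^+ (B ^ i)); apply: contraNneq nz => Fx0.
rewrite -Fx0 /mmap mevalE horner_sum; apply/eqP/eq_bigr => m' _.
rewrite hornerM hornerC /mmap1 horner_prod; congr (_ * _).
by apply: eq_bigr => i _; rewrite /h !hornerE.
Qed.

(** * Algebraic dependence of n + 1 polynomials in n variables *)
Lemma msize_prod_exp (K : fieldType) (n n' G B : nat) (q : 'I_n' -> {mpoly K[n]})
   (e : 'I_n' -> nat) :
  (forall i, msize (q i) <= G.+1)%N -> (forall i, e i <= B)%N ->
  (msize (\prod_i q i ^+ e i) <= (n' * (B * G)).+1)%N.
Proof.
have leM (f g : {mpoly K[n]}) a b : (msize f <= a.+1)%N -> (msize g <= b.+1)%N ->
    (msize (f * g) <= (a + b).+1)%N.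
  have [->|f0] := eqVneq f 0; first by rewrite mul0r mmeasure0.
  have [->|g0] := eqVneq g 0; first by rewrite mulr0 mmeasure0.
  rewrite msizeM // -subn1 leq_subLR add1n -addnS -addSn; exact: leq_add.
have leX (f : {mpoly K[n]}) a b :
    (msize f <= a.+1)%N -> (msize (f ^+ b) <= (b * a).+1)%N.
  move=> lef; elim: b => [|b IH]; first by rewrite expr0 msize1.
  by rewrite exprS mulSn; apply: leM.
move=> leq leqe; elim: n' q e leq leqe => [|n' IH] q e leq leqe.
  by rewrite big_ord0 msize1.
rewrite big_ord_recl mulSn; apply: leM; last by apply: IH.
by apply: (leq_trans (leX _ _ _ (leq ord0))); rewrite ltnS leq_mul2r leqe orbT.
Qed.

Lemma card_bmultinom_le (n d : nat) : (#|{: 'X_{1..n < d}}| <= d ^ n)%N.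
Proof.
case: d => [|d].
  by rewrite eq_card0 // => -[].
have -> : (d.+1 ^ n = #|{: {ffun 'I_n -> 'I_d.+1}}|)%N.
  by rewrite card_ffun !card_ord.
pose c (m : 'X_{1..n < d.+1}) : {ffun 'I_n -> 'I_d.+1} := [ffun i => inord (m i)].
apply: (@leq_card _ _ c) => m1 m2 /ffunP eq_c; apply/val_inj/mnmP => i.
have lt (m : 'X_{1..n < d.+1}) : (bmnm m i < d.+1)%N.
  by apply: leq_ltn_trans (bmdeg m); rewrite mdegE (bigD1 i) //= leq_addr.
by have := congr1 val (eq_c i); rewrite !ffunE /= !inordK.
Qed.

(** With exponents at most B there are (B+1)^n' monomials in the q_i, all of
degree at most n'BG, where G bounds the degrees of the q_i. The space of
polynomials of that degree in n variables has dimension growing like B^n only,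
so for large B the monomials in the q_i are linearly dependent. *)
Lemma algebraic_dependence (K : fieldType) (n n' : nat) (q : 'I_n' -> {mpoly K[n]}) :
  (n < n')%N ->
  exists2 F : {mpoly K[n']}, F != 0 &
    forall v, F.@[fun i => (q i).@[v]] = 0.
Proof.
move=> ltn; pose G := \max_i msize (q i).
(* D <= L * (B + 1), so that D ^ n <= L ^ n * (B + 1) ^ n < (B + 1) ^ n.+1 as
   soon as L ^ n <= B. *)
pose L := (n' * G).+1; pose B := (L ^ n)%N.
pose D := (n' * (B * G)).+1.
pose rowT := {ffun 'I_n' -> 'I_B.+1}.
pose Q (e : rowT) := \prod_i q i ^+ e i.
have leQ e : (msize (Q e) <= D)%N.
  apply: msize_prod_exp => i; last by rewrite -ltnS.
  by apply: leq_trans (leqnSn _); apply: leq_bigmax.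
pose A : 'M[K]_(#|{: rowT}|, #|{: 'X_{1..n < D}}|) :=
  \matrix_(e, m) (Q (enum_val e))@_(bmnm (enum_val m)).
have lt_card : (#|{: 'X_{1..n < D}}| < #|{: rowT}|)%N.
  apply: leq_ltn_trans (card_bmultinom_le _ _) _.
  rewrite card_ffun !card_ord.
  have leD : (D <= L * B.+1)%N.
    by rewrite /D /L mulnCA mulnC; apply: ltn_mul.
  apply: (@leq_ltn_trans ((L * B.+1) ^ n)%N).
    by have [->|n0] := posnP n; rewrite ?expn0 ?leq_exp2r.
  rewrite expnMn; apply: (@leq_trans (B.+1 ^ n.+1)%N); last by rewrite leq_pexp2l.
  by rewrite expnS ltn_pmul2r ?expn_gt0.
(* A has more rows than columns, so its rows satisfy a linear relation u. *)
have [u /eqP kerA u0] : exists2 u : 'rV_#|{: rowT}|, u *m A == 0 & u != 0.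
  have : kermx A != 0.
    by rewrite kermx_eq0 /row_free neq_ltn (leq_ltn_trans (rank_leq_col A)).
  move=> /rowV0Pn [u /sub_kermxP uA u0]; exists u => //; exact/eqP.
pose mon (e : rowT) : 'X_{1..n'} := [multinom nat_of_ord (e i) | i < n'].
exists (\sum_e u 0 (enum_rank e) *: 'X_[mon e]).
  apply: contraNneq u0 => F0; apply/eqP/rowP => j; rewrite mxE.
  have := congr1 (mcoeff (mon (enum_val j))) F0.
  rewrite raddf_sum mcoeff0 (bigD1 (enum_val j)) //= big1 => [|e ne].
    by rewrite mcoeffZ mcoeffX eqxx mulr1 addr0 enum_valK.
  rewrite mcoeffZ mcoeffX; case: eqP => [/mnmP eq_m|]; last by rewrite mulr0.
  case/eqP: ne; apply/ffunP => i; apply/val_inj.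
  by have := eq_m i; rewrite !mnmE.
have comb0 : \sum_e u 0 (enum_rank e) *: Q e = 0.
  apply/mpolyP => m; rewrite raddf_sum mcoeff0 /=.
  have [ltmD|geD] := ltnP (mdeg m) D; last first.
    apply: big1 => e _; rewrite mcoeffZ [X in _ * X]memN_msupp_eq0 ?mulr0 //.
    by apply: msize_mdeg_ge; apply: leq_trans (leQ e) geD.
  have /rowP/(_ (enum_rank (BMultinom ltmD))) := kerA.
  rewrite !mxE => kA; rewrite -[RHS]kA (reindex (@enum_rank _)) /=; last first.
    by apply: onW_bij; exact: enum_rank_bij.
  by apply: eq_bigr => e _; rewrite mcoeffZ mxE !enum_rankK.
move=> v; have := congr1 (meval v) comb0; rewrite meval0 !raddf_sum /= => cQ.
rewrite -[RHS]cQ.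
apply: eq_bigr => e _; rewrite !mevalZ mevalX rmorph_prod /=; congr (_ * _).
by apply: eq_bigr => i _; rewrite rmorphXn /= mnmE.
Qed.

(** * Hermite interpolation along polynomials *)

(** As p'(0) <> 0, p - p(0) vanishes to order exactly one at 0, so the order of
vanishing of s(p) at 0 equals that of s at p(0). *)
Lemma dvdp_comp_order (K : fieldType) (s p : {poly K}) (E : nat) :
  p`_1 != 0 -> (forall l, (l < E)%N -> (s \Po p)`_l = 0) ->
  ('X - (p`_0)%:P) ^+ E %| s.
Proof.
move=> p1 s0; have [->|s_neq0] := eqVneq s 0; first exact: dvdp0.
have [e [q]] := multiplicity_XsubC s p`_0; rewrite s_neq0 /= => nr def_s.
have [ltE|geE] := ltnP e E; last first.
  by rewrite def_s dvdp_mull // dvdp_exp2l.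
pose h := drop_poly 1 p.
have ph : p - (p`_0)%:P = h * 'X.
  apply/polyP => -[|l]; rewrite coefMX coefB coefC ?subrr //=.
  by rewrite coef_drop_poly addn1 subr0.
have /eqP := s0 e ltE.
rewrite def_s comp_polyM rmorphXn /= comp_polyB comp_polyX comp_polyC ph.
rewrite exprMn mulrA coefMXn ltnn subnn -horner_coef0 hornerM horner_exp.
rewrite horner_comp !horner_coef0 coef_drop_poly mulf_eq0 expf_eq0.
by rewrite (negPf p1) andbF orbF -rootE (negPf nr).
Qed.

(** s is divisible by the pairwise coprime powers (X - p_i(0))^E, whose product
has degree kE. *)
Lemma hermite_unique (K : fieldType) (k E : nat) (p : 'I_k -> {poly K}) (s : {poly K}) :
  injective (fun i => (p i)`_0) -> (forall i, (p i)`_1 != 0) ->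
  (size s <= k * E)%N ->
  (forall i l, (l < E)%N -> (s \Po p i)`_l = 0) -> s = 0.
Proof.
move=> inj0 p1 sz_s s0.
pose Q (t : seq 'I_k) := \prod_(a <- [seq (p i)`_0 | i <- t]) ('X - a%:P).
have dvdQ t : uniq t -> Q t ^+ E %| s.
  elim: t => [|i t IH] /=; first by rewrite /Q big_nil expr1n dvd1p.
  move=> /andP[nit ut]; rewrite /Q map_cons big_cons exprMn Gauss_dvdp.
    by rewrite IH // andbT; apply: dvdp_comp_order => // l; exact: s0.
  rewrite coprimep_expl ?coprimep_expr // coprimep_sym coprimep_XsubC.
  by rewrite root_prod_XsubC (mem_map inj0).
apply/eqP; apply: contraT => s_neq0.
have := dvdp_leq s_neq0 (dvdQ _ (enum_uniq 'I_k)).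
rewrite leqNgt (leq_ltn_trans sz_s) // polySpred; last first.
  by rewrite expf_neq0 // monic_neq0 // monic_prod_XsubC.
by rewrite ltnS size_exp size_prod_XsubC size_map size_enum_ord.
Qed.

(** It suffices that a avoid the roots of the nonzero product of the
differences p_i - p_j and of the derivatives p_i'; the latter are nonzero
because the characteristic is zero. *)
Lemma exists_separating_translation (K : fieldType) (charK0 : [pchar K] =i pred0)
    (k : nat) (p : 'I_k -> {poly K}) :
  injective p -> (forall i, (1 < size (p i))%N) ->
  exists a : K, injective (fun i => (p i \Po ('X + a%:P))`_0) /\
    forall i, (p i \Po ('X + a%:P))`_1 != 0.
Proof.
move=> inj_p nc_p.
pose D := (\prod_i \prod_(j | j != i) (p i - p j)) * \prod_i (p i)^`().
have D0 : D != 0.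
  rewrite mulf_neq0 //; apply/prodf_neq0 => i _.
    by apply/prodf_neq0 => j ne; rewrite subr_eq0 (inj_eq inj_p) eq_sym.
  apply/eqP => /(congr1 (fun q : {poly K} => q`_(size (p i)).-2)).
  rewrite coef_deriv coef0 -mulr_natr.
  case def_n: (size (p i)) (nc_p i) => [|[|n]] // _.
  apply/eqP; rewrite mulf_eq0 (pcharf0P _).1 //= orbF.
  have : lead_coef (p i) != 0 by rewrite lead_coef_eq0 -size_poly_eq0 def_n.
  by rewrite /lead_coef def_n.
have [a] := exists_nonroot charK0 D0.
rewrite /D hornerM !horner_prod mulf_eq0 => /norP[/prodf_neq0 dist /prodf_neq0 der].
exists a; split=> [i j|i].
  rewrite -!horner_coef0 !horner_comp !hornerE => eq_ij.
  apply/eqP; apply: contraT => ne; have /eqP[] := dist i isT.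
  by rewrite horner_prod (bigD1 j) 1?eq_sym //= hornerD hornerN eq_ij subrr mul0r.
have -> : (p i \Po ('X + a%:P))`_1 = (p i \Po ('X + a%:P))^`()`_0.
  by rewrite coef_deriv.
rewrite -horner_coef0 deriv_comp derivD derivX derivC addr0 mulr1.
by rewrite horner_comp !hornerE der.
Qed.

(** Row j = iE + l, with i < k.+1 and l < E, reads off the coefficient of t^l in
s(p_i); the rows from k.+1 * E on read off coefficients of s and complete these
jets to a square system. *)
Definition hermite_mx (R : comNzRingType) (k E N : nat) (p : 'I_k.+1 -> {poly R}) :
    'M[R]_N :=
  \matrix_(j, n) if (j < k.+1 * E)%N then (p (inord (j %/ E)) ^+ n)`_(j %% E)
                  else (j == n)%:R.

(** The right-hand side of the system whose matrix is [hermite_mx]. *)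
Definition hermite_data (R : comNzRingType) (k E : nat) (p : 'I_k.+1 -> {poly R})
    (s : {poly R}) (j : nat) : R :=
  if (j < k.+1 * E)%N then (s \Po p (inord (j %/ E)))`_(j %% E) else s`_j.

Lemma jet_index_lt (k E : nat) (i : 'I_k) (l : nat) :
  (l < E)%N -> (i * E + l < k * E)%N.
Proof.
move=> ltl; apply: (@leq_trans (i.+1 * E)%N); first by rewrite mulSnr ltn_add2l.
by rewrite leq_mul2r ltn_ord orbT.
Qed.

Lemma hermite_data_jet (R : comNzRingType) (k E : nat)
    (p : 'I_k.+1 -> {poly R}) (s : {poly R}) (i : 'I_k.+1) (l : nat) :
  (l < E)%N -> hermite_data E p s (i * E + l) = (s \Po p i)`_l.
Proof.
move=> ltl; rewrite /hermite_data jet_index_lt //.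
have E0 : (0 < E)%N by exact: leq_ltn_trans ltl.
by rewrite divnMDl // divn_small // addn0 modnMDl modn_small // inord_val.
Qed.
Lemma map_hermite_mx (R S : comNzRingType) (f : {rmorphism R -> S}) (k E N : nat)
    (p : 'I_k.+1 -> {poly R}) :
  map_mx f (hermite_mx E N p) = hermite_mx E N (fun i => map_poly f (p i)).
Proof.
apply/matrixP => j n; rewrite !mxE; case: ifP => _; last by rewrite rmorph_nat.
by rewrite -rmorphXn coef_map.
Qed.

Lemma hermite_mxE (R : comNzRingType) (k E N : nat) (p : 'I_k.+1 -> {poly R})
    (s : {poly R}) (j : 'I_N) : (size s <= N)%N ->
  (hermite_mx E N p *m \col_n s`_n) j 0 = hermite_data E p s j.
Proof.
move=> sz_s; rewrite mxE /hermite_data.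
case: ifP => [lt_j|ge_j]; last first.
  rewrite (bigD1 j) //= big1 => [|n ne]; first by rewrite !mxE ge_j eqxx mul1r addr0.
  by rewrite !mxE ge_j eq_sym (negPf ne) mul0r.
rewrite coef_comp_poly (big_ord_widen _ 
  (fun n => s`_n * (p (inord (j %/ E)) ^+ n)`_(j %% E)) sz_s).
rewrite [RHS]big_mkcond; apply: eq_bigr => n _; rewrite !mxE lt_j mulrC.
by case: ltnP => // le; rewrite nth_default // mul0r.
Qed.

(** A vector in the kernel is a polynomial s of degree less than k.+1 * E, all of
whose jets along the p_i vanish; by [hermite_unique] it is zero. *)
Lemma hermite_det_neq0 (K : fieldType) (k E N : nat) (p : 'I_k.+1 -> {poly K}) :
  (k.+1 * E <= N)%N ->
  injective (fun i => (p i)`_0) -> (forall i, (p i)`_1 != 0) ->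
  \det (hermite_mx E N p) != 0.
Proof.
move=> leN inj0 p1; rewrite -det_tr; apply/det0P => -[v v0 vA0].
case/eqP: v0; pose s := rVpoly v.
have sz_s : (size s <= N)%N by exact: size_poly.
have v_s : v^T = \col_n s`_n.
  by apply/colP => n; rewrite !mxE coef_rVpoly_ord.
have data0 j : (j < N)%N -> hermite_data E p s j = 0.
  move=> ltj; rewrite -(hermite_mxE E p (Ordinal ltj) sz_s) -v_s.
  by rewrite -[X in X *m _]trmxK -trmx_mul vA0 !mxE.
suff s0 : s = 0 by rewrite -[v]rVpolyK -/s s0 linear0.
apply: (hermite_unique (E := E) inj0 p1) => [|i l ltl].
  apply/leq_sizeP => j lej; have [ltj|] := ltnP j N; last first.
    by move=> leNj; rewrite nth_default // (leq_trans sz_s).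
  by have := data0 j ltj; rewrite /hermite_data ltnNge lej.
rewrite -(hermite_data_jet p s i ltl); apply: data0.
by apply: leq_trans leN; exact: jet_index_lt.
Qed.

(** * The polynomials with a linear dependence *)

(** The statement singles out the relations in which s(p_0) is a combination of
the others; any relation takes this form after a permutation of the p_i. By
Cramer's rule d s = adj X y, where X is the interpolation matrix, d its
determinant and y the interpolation data of s. The division by d need not be
performed: the free entries of y are replaced by their quotients by d, which are
just other values of the same parameters, and s becomes a polynomial function of
r parameters. *)
Lemma dependence_locus (K : fieldType) (k m r E : nat) :
  E = (k.+1 * m.+1 + k.+1)%N -> (k.+1 * E <= r)%N ->
  exists2 F : {mpoly K[r.+1]}, F != 0 &
    forall (s : {poly K}) (p : 'I_k.+1 -> {poly K}) (c : 'I_k -> K),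
      (size s <= r.+1)%N -> (forall i, (size (p i) <= m.+1)%N) ->
      injective (fun i => (p i)`_0) -> (forall i, (p i)`_1 != 0) ->
      s \Po p ord0 = \sum_i c i *: (s \Po p (lift ord0 i)) ->
      F.@[fun n : 'I_r.+1 => s`_n] = 0.
Proof.
move=> def_E le_kE.
have E0 : (0 < E)%N by rewrite def_E addnS.
have le_Er : (E <= r)%N by apply: leq_trans le_kE; rewrite leq_pmull.
(* The parameters: the coefficients of the p_i, those of the relation, and the
   entries of index at least E of the rescaled interpolation data. *)
pose T : finType := ('I_k.+1 * 'I_m.+1 + 'I_k + 'I_(r - E).+1)%type.
have cardT : #|T| = r.
  rewrite !card_sum card_prod !card_ord.
  have -> : (k.+1 * m.+1 + k = E.-1)%N by rewrite def_E addnS.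
  by rewrite addnS -addSn prednK // subnKC.
pose V (x : T) : {mpoly K[#|T|]} := 'X_(enum_rank x).
pose P (i : 'I_k.+1) : {poly {mpoly K[#|T|]}} :=
  \poly_(l < m.+1) V (inl (inl (i, inord l))).
pose W (j : nat) := V (inr (inord (j - E))).
(* The entries of index less than E are the jet of s(p_0), which the relation
   computes from the other jets. *)
pose Y (j : nat) :=
  if (j < E)%N then \sum_(i < k) V (inl (inr i)) * W (i.+1 * E + j)%N else W j.
pose Psi (n : 'I_r.+1) :=
  (\adj (hermite_mx E r.+1 P) *m \col_(j < r.+1) Y j) n 0.
have [F F0 FPsi] : exists2 F : {mpoly K[r.+1]}, F != 0 &
    forall v, F.@[fun n => (Psi n).@[v]] = 0.
  by apply: algebraic_dependence; rewrite cardT.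
exists F => // s p c sz_s sz_p inj0 p1 dep.
pose X := hermite_mx E r.+1 p; pose d := \det X.
have d0 : d != 0.
  by apply: hermite_det_neq0 => //; apply: leq_trans le_kE _.
pose y := hermite_data E p s.
(* The parameter values that produce s. *)
pose v (x : 'I_#|T|) : K := match enum_val x with
  | inl (inl (i, l)) => (p i)`_l
  | inl (inr i) => c i
  | inr l => d^-1 * y (l + E)%N
  end.
have vV x : (V x).@[v] = match x with
  | inl (inl (i, l)) => (p i)`_l
  | inl (inr i) => c i
  | inr l => d^-1 * y (l + E)%N
  end by rewrite mevalXU /v enum_rankK.
have vP i : map_poly (meval v) (P i) = p i.
  apply/polyP => l; rewrite coef_map coef_poly.
  case: ltnP => [ltl|gel]; first by rewrite /= vV inordK.
  by rewrite /= meval0 nth_default // (leq_trans (sz_p i)).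
have vW j : (E <= j < r.+1)%N -> (W j).@[v] = d^-1 * y j.
  move=> /andP[leE ltr]; rewrite vV inordK ?subnK //.
  by rewrite ltnS leq_sub2r.
have vY (j : 'I_r.+1) : (Y j).@[v] = d^-1 * y j.
  rewrite /Y; case: ltnP => [ltj|gej]; last by rewrite vW ?gej ?ltn_ord.
  have -> : y j = (s \Po p ord0)`_j by rewrite -(hermite_data_jet p s ord0 ltj).
  rewrite dep coef_sum raddf_sum mulr_sumr; apply: eq_bigr => i _ /=.
  have lt_ij : (i.+1 * E + j < r.+1)%N.
    rewrite ltnS; apply: leq_trans le_kE.
    by rewrite ltnW // (jet_index_lt (lift ord0 i)).
  rewrite mevalM vV vW; last by rewrite lt_ij andbT mulSn -addnA leq_addr.
  by rewrite -[i.+1]/(nat_of_ord (lift ord0 i)) /y hermite_data_jet // coefZ mulrCA.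
have vAdj : map_mx (meval v) (\adj (hermite_mx E r.+1 P)) = \adj X.
  rewrite map_mx_adj map_hermite_mx; congr (\adj _).
  by apply/matrixP => a b; rewrite !mxE vP.
have vPsi n : (Psi n).@[v] = s`_n.
  have -> : (Psi n).@[v] = (\adj X *m (d^-1 *: (X *m \col_n s`_n))) n 0.
    rewrite /Psi mxE [RHS]mxE raddf_sum; apply: eq_bigr => j _ /=.
    rewrite mevalM -vAdj [X in _ = X * _]mxE; congr (_ * _).
    by rewrite mxE vY [RHS]mxE hermite_mxE.
  by rewrite -scalemxAr mulmxA mul_adj_mx mul_scalar_mx scalerA mulVf // scale1r mxE.
by rewrite -[RHS](FPsi v); apply: meval_eq => n; rewrite vPsi.
Qed.

Theorem theorem2p5 (K : fieldType) (charK0 : [pchar K] =i pred0)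
  (m k r : nat) (m_ge1 : (1 <= m)%N) (k_ge1 : (1 <= k)%N)
  (r_ge : (k%:R * (k%:R * (m%:R + 1) + k%:R + m%:R * (k%:R - 1) / 2%:R)
             <= r%:R :> rat)) :
  exists U : {poly_(r.+1) K} -> Prop,
    [/\ zariski_open U,
        exists s, U s &
        forall sigma : {poly_(r.+1) K}, U sigma ->
        forall p : 'I_k -> {poly K},
          injective p ->
          (forall i, (1 < size (p i))%N) ->
          (forall i, (size (p i) <= m.+1)%N) ->
          lin_indep (fun i => (sigma : {poly K}) \Po p i)].
Proof.
case: k k_ge1 r_ge => // k _ r_ge.
have le_kE : (k.+1 * (k.+1 * m.+1 + k.+1) <= r)%N.
  rewrite -(ler_nat rat); apply: le_trans r_ge.
  rewrite natrM natrD natrM -[m.+1]addn1 natrD ler_wpM2l ?ler0n //.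
  rewrite lerDl divr_ge0 ?ler0n // mulr_ge0 ?ler0n //.
  by rewrite -natr1 addrK ler0n.
have [F F0 FZ] := dependence_locus K (erefl _) le_kE.
exists (fun s => F.@[coefs s] != 0); split.
- exists (eq F) => s; split=> [/negP|Z]; first by rewrite negbK => /eqP Fs0 _ <-.
  by apply/negP; rewrite negbK; apply/eqP/Z.
- have [v nz] := exists_meval_neq0 charK0 F0.
  exists (npolyp r.+1 (rVpoly (\row_i v i))).
  apply: contra_neq nz; rewrite (meval_eq (v2 := v)) // => i.
  by rewrite /coefs coef_npolyp ltn_ord coef_rVpoly_ord mxE.
move=> s Us p inj_p nc_p sz_p c dep i0.
apply/eqP; apply: contraT => ci0; case/negP: Us; apply/eqP.
have [a [inj0 p1]] := exists_separating_translation charK0 inj_p nc_p.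
(* Bring to the first place an index whose coefficient in the relation is not
   zero. *)
pose t := tperm ord0 i0.
pose q i := p (t i) \Po ('X + a%:P).
have sz_s : (size (s : {poly K}) <= r.+1)%N by exact: size_npoly.
apply: (FZ s q (fun i => - (c i0)^-1 * c (t (lift ord0 i)))) => //.
- move=> i; rewrite size_comp_poly2 ?sz_p // size_XaddC //.
- by move=> i j /inj0/perm_inj.
- by move=> i; exact: p1.
have compq i : (s : {poly K}) \Po q i = (s \Po p (t i)) \Po ('X + a%:P).
  by rewrite comp_polyA.
have p_i0 : s \Po p i0 = \sum_(i < k)
    (- (c i0)^-1 * c (t (lift ord0 i))) *: (s \Po p (t (lift ord0 i))).
  apply: (scalerI ci0); move: dep.
  rewrite (reindex_inj (@perm_inj _ t)) big_ord_recl /= tpermL => /eqP.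
  rewrite addr_eq0 => /eqP ->; rewrite scaler_sumr -sumrN; apply: eq_bigr => i _.
  by rewrite scalerA mulrA mulrN mulfV // mulN1r scaleNr.
rewrite compq tpermL p_i0 raddf_sum; apply: eq_bigr => i _ /=.
by rewrite comp_polyZ compq.
Qed.
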